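(* Let $\Omega \subset \mathbb{R}^d$ be a bounded domain and let $\mu,\nu$ be Borel probability measures on $\Omega$. Then $$W_1(\mu,\nu) = \sup\left\{ \int_\Omega \phi \, \mathrm{d}(\mu - \nu) \;:\; \phi \in C(\Omega),\ \phi(x) - \phi(y) \leq |x-y| \text{ for all } (x,y) \in \operatorname{supp}(\mu) \times \operatorname{supp}(\nu) \right\}.$$
   Context: $C(\Omega)$ denotes the set of bounded continuous real-valued functions on $\Omega$. The 1-Wasserstein distance is $W_1(\mu,\nu) := \min\{ \int_{\Omega\times\Omega} |x-y| \,\mathrm{d}\gamma(x,y) : \gamma \in \Pi(\mu,\nu)\}$, where $\Pi(\mu,\nu)$ is the set of Borel probability measures $\gamma$ on $\Omega\times\Omega$ with $\gamma(A\times\Omega)=\mu(A)$ and $\gamma(\Omega\times A)=\nu(A)$ for all measurable $A\subset\Omega$. $|\cdot|$ is the Euclidean norm. The condition $\phi(x)-\phi(y)\le|x-y|$ on $\operatorname{supp}(\mu)\times\operatorname{supp}(\nu)$ is called the universal admissible condition. *)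

(* Defs.v *)
From HB Require Import structures.
From mathcomp Require Import all_boot all_order all_algebra.
From mathcomp Require Import all_classical all_reals all_analysis.
Set Implicit Arguments. Unset Strict Implicit. Unset Printing Implicit Defensive.
Import Order.TTheory GRing.Theory Num.Theory.
Import numFieldNormedType.Exports.
Local Open Scope classical_set_scope.
Local Open Scope ring_scope.

Definition eucl {R : realType} {d : nat} (x : 'rV[R]_d) : R :=
  Num.sqrt (\sum_(i < d) x ord0 i ^+ 2).

Definition Rd (R : realType) (d : nat) := g_sigma_algebraType (@open 'rV[R]_d).

Definition bounded_domain {R : realType} {d : nat} (Om : set 'rV[R]_d) : Prop :=
  Om !=set0 /\ open Om /\ connected Om /\
  exists M : R, forall x, Om x -> eucl x <= M.

(* A Borel probability measure on Om: a Borel probability measure on R^d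
   giving no mass to the complement of Om *)
Definition prob_on {R : realType} {d : nat} (Om : set 'rV[R]_d)
  (mu : probability (Rd R d) R) : Prop :=
  mu (~` Om : set (Rd R d)) = 0%E.

Definition supp {R : realType} {d : nat} (Om : set 'rV[R]_d)
  (mu : probability (Rd R d) R) : set 'rV[R]_d :=
  [set x | Om x /\ forall U : set 'rV[R]_d, open U -> U x ->
     (0 < mu (U : set (Rd R d)))%E].

Definition coupling {R : realType} {d : nat}
  (mu nu : probability (Rd R d) R)
  (gam : probability (Rd R d * Rd R d)%type R) : Prop :=
  forall A : set (Rd R d), measurable A ->
    gam (A `*` setT) = mu A /\ gam (setT `*` A) = nu A.

Definition W1 {R : realType} {d : nat} (Om : set 'rV[R]_d)
  (mu nu : probability (Rd R d) R) : \bar R :=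
  ereal_inf [set c | exists gam : probability (Rd R d * Rd R d)%type R,
    coupling mu nu gam /\
    c = (\int[gam]_(p in (Om `*` Om : set (Rd R d * Rd R d)))
           (eucl ((p.1 : 'rV[R]_d) - (p.2 : 'rV[R]_d)))%:E)%E].

Definition Cb {R : realType} {d : nat} (Om : set 'rV[R]_d)
  (phi : 'rV[R]_d -> R) : Prop :=
  {within Om, continuous phi} /\ exists M : R, forall x, Om x -> `|phi x| <= M.

Definition admissible {R : realType} {d : nat} (Om : set 'rV[R]_d)
  (mu nu : probability (Rd R d) R) (phi : 'rV[R]_d -> R) : Prop :=
  forall x y, supp Om mu x -> supp Om nu y -> phi x - phi y <= eucl (x - y).

(* Main.v *)
Require Import Defs.
From HB Require Import structures.
From mathcomp Require Import all_boot all_order all_algebra.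
From mathcomp Require Import all_classical all_reals all_analysis.
From mathcomp Require Import measurable_realfun ring lra.
Import Order.TTheory GRing.Theory Num.Theory.
Import numFieldNormedType.Exports.
Local Open Scope classical_set_scope.
Local Open Scope ring_scope.

(* Every coupling of mu and nu is concentrated on supp mu x supp nu, so integrating
   phi x - phi y <= |x - y| against it shows that the supremum is at most W_1.
   Conversely, cut Om into finitely many cells C_i of small diameter around points c_i
   and apply finite linear programming duality to the weights mu C_i and nu C_j with
   costs |c_i - c_j|. The resulting plan lambda lifts to the coupling
   sum_ij lambda_ij (mu|C_i x nu|C_j) / (mu C_i * nu C_j), while a feasible dual pair
   (phi_i, psi_j) is dominated by the single 1-Lipschitz function
   min_j (|x - c_j| + psi_j). As W_1 is an infimum, letting the diameter tend to 0
   suffices, and no weak compactness of couplings is needed. *)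

(** * Finite linear programming duality *)

(* Bartl's induction: if the first m forms do not suffice, pick a witness z with
   al_i z <= 0 < ga z and al_m z = 1, and project everything along z onto the kernel
   of al_m. *)
Lemma farkas (F : realFieldType) (V : lmodType F) (al : nat -> V -> F)
    (m : nat) (ga : V -> F) :
  (forall i a x y, al i (a *: x + y) = a * al i x + al i y) ->
  (forall a x y, ga (a *: x + y) = a * ga x + ga y) ->
  (forall x, (forall i, (i < m)%N -> al i x <= 0) -> ga x <= 0) ->
  exists2 la : nat -> F, (forall i, 0 <= la i) &
    forall x, ga x = \sum_(i < m) la i * al i x.
Proof.
elim: m al ga => [|m IH] al ga hal hga H.
  (* With no constraints, [ga] is nonpositive at both [x] and [- x], hence zero. *)
  exists (fun=> 0) => // x; rewrite big_ord0; apply/le_anti/andP; split.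
    exact: H.
  have ga0 : ga 0 = 0.
    by have := hga (-1) 0 0; rewrite scaler0 addr0 mulN1r addNr.
  have /H : forall i, (i < 0)%N -> al i (- x) <= 0 by [].
  by have := hga (-1) x 0; rewrite addr0 ga0 addr0 scaleN1r mulN1r => ->; rewrite oppr_le0.
have [Hm|] := pselect (forall x, (forall i, (i < m)%N -> al i x <= 0) -> ga x <= 0).
  have [la la0 laE] := IH al ga hal hga Hm.
  exists (fun i => if (i < m)%N then la i else 0) => [i|x]; first by case: ifP.
  rewrite big_ord_recr /= ltnn mul0r addr0 laE.
  by apply: eq_bigr => i _; rewrite ltn_ord.
move=> /existsNP[z0 /not_implyP[z0al /negP]]; rewrite -ltNge => z0ga.
have amz0 : 0 < al m z0.
  rewrite ltNge; apply/negP => amz0; suff: ga z0 <= 0 by rewrite leNgt z0ga.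
  by apply: H => i; rewrite ltnS leq_eqVlt => /predU1P[->//|]; exact: z0al.
pose z := (al m z0)^-1 *: z0.
have al0 i : al i 0 = 0.
  by have := hal i (-1) 0 0; rewrite scaler0 addr0 mulN1r addNr.
have ga0 : ga 0 = 0.
  by have := hga (-1) 0 0; rewrite scaler0 addr0 mulN1r addNr.
have alZ i a x : al i (a *: x) = a * al i x.
  by have := hal i a x 0; rewrite addr0 al0 addr0.
have gaZ a x : ga (a *: x) = a * ga x.
  by have := hga a x 0; rewrite addr0 ga0 addr0.
have amz : al m z = 1 by rewrite alZ mulVf// gt_eqF.
have zal i : (i < m)%N -> al i z <= 0.
  by move=> im; rewrite alZ; apply: mulr_ge0_le0; [rewrite invr_ge0 ltW|exact: z0al].
have zga : 0 <= ga z by rewrite gaZ mulr_ge0// ?invr_ge0 ltW.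
(* The projected forms are [al i] and [ga] at [x - al m x *: z], a point where [al m] vanishes, so
   [H] applies there. *)
have [||x xal|la la0 laE] := IH (fun i x => al i x - al i z * al m x)
  (fun x => ga x - ga z * al m x).
- by move=> i a x y; rewrite !hal; ring.
- by move=> a x y; rewrite hal hga; ring.
- have -> : ga x - ga z * al m x = ga (- al m x *: z + x) by rewrite hga; ring.
  apply: H => i; rewrite ltnS leq_eqVlt => /predU1P[->|im].
    by rewrite hal amz mulr1 addNr.
  by rewrite hal; apply: le_trans (xal i im); rewrite mulNr mulrC addrC.
(* The last multiplier collects the coefficients of [al m x] in the expanded identity; it is
   nonnegative because [al j z <= 0 <= ga z]. *)
- exists (fun i => if (i < m)%N then la i else ga z - \sum_(j < m) la j * al j z).
    move=> i; case: ifP => // _; rewrite subr_ge0; apply: (le_trans _ zga).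
    by apply: sumr_le0 => j _; rewrite mulr_ge0_le0// zal.
  move=> x; rewrite big_ord_recr /= ltnn; have /eqP := laE x.
  rewrite subr_eq => /eqP->; rewrite mulrBl addrA addrAC; congr (_ + _).
  rewrite mulr_suml -sumrB; apply: eq_bigr => i _; rewrite ltn_ord; ring.
Qed.

(* Farkas' lemma is applied to triples (phi, psi, t), where t >= 0 homogenises the
   constraints to phi_i - psi_j <= t c_ij. *)
Lemma finite_duality (F : realFieldType) (n : nat) (c : 'I_n -> 'I_n -> F)
    (a b : 'I_n -> F) (v : F) :
  (forall i, 0 <= a i) -> (forall j, 0 <= b j) ->
  \sum_i a i = 1 -> \sum_j b j = 1 ->
  (forall phi psi : 'I_n -> F, (forall i j, phi i - psi j <= c i j) ->
     \sum_i phi i * a i - \sum_j psi j * b j <= v) ->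
  exists la : 'I_n -> 'I_n -> F,
    [/\ forall i j, 0 <= la i j,
        forall i, \sum_j la i j = a i,
        forall j, \sum_i la i j = b j &
        \sum_i \sum_j la i j * c i j <= v].
Proof.
move=> a0 b0 a1 b1 Hv.
pose V := (('rV[F]_n * 'rV[F]_n) * F^o)%type.
pose N := #|{: 'I_n * 'I_n}|.
(* Indices below [N] enumerate the pairs [(i, j)]; index [N] carries the sign constraint on the
   homogenising variable. *)
pose al (k : nat) (x : V) : F :=
  if insub k is Some k' then
    x.1.1 0 (enum_val (k' : 'I_N)).1 - x.1.2 0 (enum_val k').2
      - c (enum_val k').1 (enum_val k').2 * x.2
  else - x.2.
pose ga (x : V) : F := \sum_i x.1.1 0 i * a i - \sum_j x.1.2 0 j * b j - v * x.2.
have hal k s x y : al k (s *: x + y) = s * al k x + al k y.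
  rewrite /al; case: insubP => [k' _ _|_] /=; rewrite ?mxE /GRing.scale/=; ring.
have hga s x y : ga (s *: x + y) = s * ga x + ga y.
  rewrite /ga (_ : (s *: x + y).2 = s * x.2 + y.2)// !mulrBr !mulr_sumr.
  under eq_bigr do rewrite !mxE mulrDl -mulrA.
  under [X in _ - X - _]eq_bigr do rewrite !mxE mulrDl -mulrA.
  rewrite !big_split /=; ring.
have alE (i j : 'I_n) x : al (enum_rank (i, j)) x = x.1.1 0 i - x.1.2 0 j - c i j * x.2.
  by rewrite /al valK enum_rankK.
have alN x : al N x = - x.2 by rewrite /al insubN// ltnn.
have H x : (forall k, (k < N.+1)%N -> al k x <= 0) -> ga x <= 0.
  move=> xal.
  have xij i j : x.1.1 0 i - x.1.2 0 j - c i j * x.2 <= 0.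
    by rewrite -alE; apply: xal; rewrite ltnS ltnW.
  have : 0 <= x.2 by have := xal N (ltnSn _); rewrite alN oppr_le0.
  rewrite le_eqVlt => /predU1P[x0|x0].
    (* If [x.2 = 0], the constraints read phi_i <= psi_j, and averaging them with the product
       weights [a i * b j] gives the claim. *)
    rewrite /ga -x0 mulr0 subr0.
    have -> : \sum_i x.1.1 0 i * a i = \sum_i \sum_j x.1.1 0 i * a i * b j.
      by apply: eq_bigr => i _; rewrite -mulr_sumr b1 mulr1.
    have -> : \sum_j x.1.2 0 j * b j = \sum_i \sum_j x.1.2 0 j * a i * b j.
      rewrite exchange_big.
  apply: eq_bigr => j _ /=.
      by rewrite -mulr_suml -mulr_sumr a1 mulr1.
    rewrite -sumrB; apply: sumr_le0 => i _; rewrite -sumrB; apply: sumr_le0 => j _.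
    rewrite -!mulrBl -mulrA; apply: mulr_le0_ge0; last exact: mulr_ge0.
    by have := xij i j; rewrite -x0 mulr0 subr0.
  (* If [x.2 > 0], dividing by it yields a feasible pair. *)
  have := Hv (fun i => x.1.1 0 i / x.2) (fun j => x.1.2 0 j / x.2).
  have -> : \sum_i x.1.1 0 i / x.2 * a i - \sum_j x.1.2 0 j / x.2 * b j =
            (\sum_i x.1.1 0 i * a i - \sum_j x.1.2 0 j * b j) / x.2.
    rewrite mulrBl !mulr_suml; congr (_ - _); apply: eq_bigr => i _; exact: mulrAC.
  rewrite ler_pdivrMr// /ga subr_le0; apply => i j.
  by rewrite -mulrBl ler_pdivrMr// -subr_le0.
have [la la0 laE] := farkas F V al N.+1 ga hal hga H.
have E x : ga x = \sum_i \sum_j la (enum_rank (i, j)) *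
    (x.1.1 0 i - x.1.2 0 j - c i j * x.2) - la N * x.2.
  rewrite laE big_ord_recr /= alN mulrN; congr (_ - _).
  rewrite pair_bigA /= (reindex (@enum_rank _)) /=; last first.
    by exists enum_val => k _; [exact: enum_rankK|exact: enum_valK].
  by apply: eq_bigr => -[i j] _; rewrite alE.
(* The multipliers of the pair constraints form the plan. Evaluating [E] at a unit phi, at minus a
   unit psi and at t = -1 reads off the row sums, the column sums and the cost, with [la N >= 0] as
   slack in the last. *)
exists (fun i j => la (enum_rank (i, j))); split => //.
- move=> i; have := E ((delta_mx 0 i, 0), 0); rewrite /ga /= !mulr0 !subr0.
  rewrite (bigD1 i)//= !mxE !eqxx mul1r big1; last first.
    by move=> k ki; rewrite !mxE (negPf ki) andbF mul0r.
  rewrite big1; last by move=> k _; rewrite mxE mul0r.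
  rewrite addr0 subr0 => ->.
  rewrite [RHS](bigD1 i)//= [X in _ + X]big1 ?addr0.
    by apply: eq_bigr => j _; rewrite !mxE !eqxx mulr0 !subr0 mulr1.
  by move=> k ki; rewrite big1// => j _; rewrite /= !mxE (negPf ki) andbF
    !(opprK, oppr0, mulr0, subr0, addr0).
- move=> j; have := E ((0, - delta_mx 0 j), 0); rewrite /ga /= !mulr0 !subr0.
  rewrite big1; last by move=> k _; rewrite mxE mul0r.
  rewrite (bigD1 j)//= !mxE !eqxx mulN1r big1; last first.
    by move=> k ki; rewrite !mxE (negPf ki) andbF oppr0 mul0r.
  rewrite addr0 sub0r opprK => ->.
  rewrite exchange_big [RHS](bigD1 j)//= [X in _ + X]big1 ?addr0.
    by apply: eq_bigr => i _; rewrite !mxE !eqxx mulr0 sub0r opprK subr0 mulr1.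
  by move=> k ki; rewrite big1// => i _; rewrite /= !mxE (negPf ki) andbF
    !(opprK, oppr0, mulr0, subr0, addr0).
- have := E ((0, 0), -1); rewrite /ga /=.
  rewrite [X in X - _ - _]big1; last by move=> k _; rewrite mxE mul0r.
  rewrite [X in _ - X - _]big1; last by move=> k _; rewrite mxE mul0r.
  rewrite subr0 sub0r !mulrN1 !opprK => ->.
  rewrite -[leLHS]addr0; apply: lerD => //.
  apply: ler_sum => i _; apply: ler_sum => j _.
  by rewrite !mxE !subr0 sub0r mulrN1 opprK.
Qed.

(** * Euclidean geometry *)

Section Eucl.
Context {R : realType} {d : nat}.
Implicit Types x y z : 'rV[R]_d.

Lemma eucl_ge0 x : 0 <= eucl x.
Proof. exact: sqrtr_ge0. Qed.

Lemma eucl0 : eucl (0 : 'rV[R]_d) = 0.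
Proof. by rewrite /eucl big1 ?sqrtr0// => i _; rewrite mxE expr0n. Qed.

Lemma eucl_sym x y : eucl (x - y) = eucl (y - x).
Proof.
by rewrite /eucl; congr Num.sqrt; apply: eq_bigr => i _; rewrite !mxE -sqrrN opprB.
Qed.

Lemma eucl_sqr x : eucl x ^+ 2 = \sum_(i < d) x ord0 i ^+ 2.
Proof. by rewrite sqr_sqrtr// sumr_ge0// => i _; exact: sqr_ge0. Qed.

Lemma coord_le_eucl x i : `|x ord0 i| <= eucl x.
Proof.
rewrite -ler_sqr ?nnegrE ?eucl_ge0// eucl_sqr real_normK ?num_real//.
by rewrite (bigD1 i)//= lerDl sumr_ge0// => j _; exact: sqr_ge0.
Qed.

Lemma eucl_eq0_coord x i : eucl x = 0 -> x ord0 i = 0.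
Proof.
by move=> x0; apply/eqP; rewrite -normr_le0; have := coord_le_eucl x i; rewrite x0.
Qed.

Lemma cauchy_schwarz x y : \sum_i x ord0 i * y ord0 i <= eucl x * eucl y.
Proof.
have [y0|y0] := eqVneq (eucl y) 0.
  by rewrite y0 mulr0 big1// => i _; rewrite (eucl_eq0_coord y)// mulr0.
have y0' : 0 < eucl y by rewrite lt_def y0 eucl_ge0.
have [x0|x0] := eqVneq (eucl x) 0.
  by rewrite x0 mul0r big1// => i _; rewrite (eucl_eq0_coord x)// mul0r.
have x0' : 0 < eucl x by rewrite lt_def x0 eucl_ge0.
(* This sum of squares equals 2|x||y|(|x||y| - <x,y>); both norms are now positive, so the factor in
   front can be cancelled. *)
have : 0 <= \sum_i (eucl y * x ord0 i - eucl x * y ord0 i) ^+ 2.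
  by apply: sumr_ge0 => i _; exact: sqr_ge0.
have -> : \sum_i (eucl y * x ord0 i - eucl x * y ord0 i) ^+ 2 =
  2 * (eucl x * eucl y) * (eucl x * eucl y - \sum_i x ord0 i * y ord0 i).
  transitivity (eucl y ^+ 2 * (\sum_i x ord0 i ^+ 2) + eucl x ^+ 2 * (\sum_i y ord0 i ^+ 2)
    - 2 * (eucl x * eucl y) * \sum_i x ord0 i * y ord0 i).
    rewrite !mulr_sumr -big_split -sumrB /=; apply: eq_bigr => i _; ring.
  rewrite -!eucl_sqr; ring.
by rewrite pmulr_rge0 ?subr_ge0// !mulr_gt0.
Qed.

Lemma eucl_triangle x y : eucl (x + y) <= eucl x + eucl y.
Proof.
rewrite -ler_sqr ?nnegrE ?addr_ge0 ?eucl_ge0// sqrrD !eucl_sqr.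
have -> : \sum_i (x + y) ord0 i ^+ 2 =
  \sum_i x ord0 i ^+ 2 + 2 * (\sum_i x ord0 i * y ord0 i) + \sum_i y ord0 i ^+ 2.
  rewrite mulr_sumr -!big_split /=; apply: eq_bigr => i _; rewrite mxE; ring.
have := cauchy_schwarz x y; lra.
Qed.

Lemma eucl_dist_triangle x y z : eucl (x - z) <= eucl (x - y) + eucl (y - z).
Proof. by have := eucl_triangle (x - y) (y - z); rewrite addrA subrK. Qed.

Lemma eucl_dist_continuous y : continuous (fun x => eucl (x - y)).
Proof.
move=> x; apply: (@continuous_comp _ _ _ (fun x => \sum_(i < d) (x - y) ord0 i ^+ 2) Num.sqrt).
  apply: (@continuous_big _ _ _ _ _ _ _ (index_enum 'I_d) 
    (fun i x => (x - y) ord0 i ^+ 2)) => [|i _ {}x].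
    exact: add_continuous.
  apply: (@continuous_comp _ _ _ (fun x => (x - y) ord0 i) (fun t => t ^+ 2)).
    have -> : (fun x => (x - y) ord0 i) = (fun x => x ord0 i - y ord0 i).
      by apply/funext => z; rewrite !mxE.
    apply: (@cvgB R R^o _ (nbhs x) _ (fun z : 'rV_d => z ord0 i) (fun=> y ord0 i)).
      exact: (@coord_continuous R 1 d ord0 i x).
    exact: cvg_cst.
  exact: exprn_continuous.
exact: sqrt_continuous.
Qed.

Lemma open_eucl_ball y (e : R) : open [set x | eucl (x - y) < e].
Proof.
have -> : [set x | eucl (x - y) < e] = (fun x => eucl (x - y)) @^-1` [set t | t < e] by [].
apply: open_comp; last exact: open_lt.
by move=> x _; exact: eucl_dist_continuous.
Qed.

(** Boundedness puts [A] inside a cube, compact as a product of segments; the centres come from a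
    finite subcover by balls and may lie outside [A]. *)
Lemma finite_net (A : set 'rV[R]_d) (M e : R) : (forall x, A x -> eucl x <= M) -> 0 < e ->
  exists (n : nat) (c : 'I_n -> 'rV[R]_d),
    forall x, A x -> exists i, eucl (x - c i) < e.
Proof.
move=> AM e0.
have : compact [set v : 'rV[R]_d | forall i, `[- M, M]%classic (v ord0 i)].
  by apply: (@rV_compact _ _ (fun=> `[- M, M]%classic)) => i; exact: segment_compact.
rewrite compact_cover => /(_ 'rV[R]_d setT (fun y => [set x | eucl (x - y) < e])).
case=> [y _|x _|D _ Dcov].
- exact: open_eucl_ball.
- by exists x => //=; rewrite subrr eucl0.
exists (size (finmap.enum_fset D)), (fun i => (finmap.enum_fset D)`_i) => x Ax.
have [|y /= yD xy] := Dcov x.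
  move=> i /=; rewrite in_itv/= -ler_norml.
  exact: le_trans (coord_le_eucl _ _) (AM _ Ax).
have yi : (index y (finmap.enum_fset D) < size (finmap.enum_fset D))%N by rewrite index_mem.
by exists (Ordinal yi); rewrite /= nth_index.
Qed.

(** The topology of ['rV[R]_d] comes from the maximum norm, which the Euclidean norm dominates. *)
Lemma eucl_ball_subset (U : set 'rV[R]_d) x : open U -> U x ->
  exists2 e : R, 0 < e & [set y | eucl (y - x) < e] `<=` U.
Proof.
rewrite openE => /[apply] /nbhs_ballP[e /= e0 eU]; exists e => // y /= yx.
apply: eU; split => // i j; rewrite /ball/= ord1 distrC.
apply: le_lt_trans yx.
by have := coord_le_eucl (y - x) j; rewrite !mxE.
Qed.

End Eucl.

(** * Couplings with prescribed mass on cells *)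

Section Glue.
Context {dd : measure_display} {T : measurableType dd} {R : realType}.

Lemma measure_cells (mu : probability T R) (n : nat) (C : 'I_n -> set T) (A : set T) :
  (forall i, measurable (C i)) -> trivIset setT C ->
  mu (~` (\big[setU/set0]_i C i)) = 0%E -> measurable A ->
  mu A = (\sum_i mu (A `&` C i))%E.
Proof.
move=> mC tC muC mA.
have mU : measurable (\big[setU/set0]_i C i) by exact: bigsetU_measurable.
rewrite -measure_bigsetU_ord//; last 2 first.
- by move=> i; exact: measurableI.
- exact: trivIset_setIl.
rewrite -big_distrr /=.
rewrite -[in LHS](setIT A) -(setUv (\big[setU/set0]_i C i)) setIUr measureU//.
- rewrite [X in (_ + X)%E](_ : _ = 0%E) ?adde0//.
  apply: subset_measure0 muC => //.
  + by apply: measurableI => //; exact: measurableC.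
  + exact: measurableC.
- exact: measurableI.
- by apply: measurableI => //; exact: measurableC.
- by rewrite setIACA setICr setI0.
Qed.

Lemma sum_measure_cells (mu : probability T R) (n : nat) (C : 'I_n -> set T) :
  (forall i, measurable (C i)) -> trivIset setT C ->
  mu (~` (\big[setU/set0]_i C i)) = 0%E -> \sum_i fine (mu (C i)) = 1.
Proof.
move=> mC tC muC; apply/EFin_inj.
rewrite -sumEFin -(@probability_setT _ _ _ mu) (measure_cells _ _ _ _ mC tC muC)//.
by apply: eq_bigr => i _; rewrite setTI fineK// fin_num_measure.
Qed.

(** Normalisation leaves a measure of mass 1 unchanged and packs it as a [probability];
    [dirac point] is the default of [mnormalize] for degenerate masses. *)
Lemma measure_probability {d'} {U : measurableType d'} (m : measure U R) :
  m setT = 1%E -> exists p : probability U R, forall A, p A = m A.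
Proof.
move=> m1; exists (mnormalize m (dirac point)) => A.
by rewrite /= /mnormalize m1 onee_eq0/= invr1 mule1.
Qed.

(** On each rectangle [C i x C j] the product measure is rescaled to mass [la i j]. On [C i] the
    first marginal is then [mu] times (sum_j la i j) / mu (C i) = 1, and symmetrically for the
    second. *)
Lemma exists_coupling_on_cells (mu nu : probability T R) (n : nat) (C : 'I_n -> set T)
    (la : 'I_n -> 'I_n -> R) :
  (forall i, measurable (C i)) -> trivIset setT C ->
  mu (~` (\big[setU/set0]_i C i)) = 0%E -> nu (~` (\big[setU/set0]_i C i)) = 0%E ->
  (forall i j, 0 <= la i j) ->
  (forall i, \sum_j la i j = fine (mu (C i))) ->
  (forall j, \sum_i la i j = fine (nu (C j))) ->
  exists gam : probability (T * T)%type R,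
    (forall A, measurable A -> gam (A `*` setT) = mu A /\ gam (setT `*` A) = nu A) /\
    forall i j, gam (C i `*` C j) = (la i j)%:E.
Proof.
move=> mC tC muC nuC la0 laa lab.
pose P : measure (T * T)%type R := (mu \x nu)%E.
pose a i := fine (mu (C i)); pose b j := fine (nu (C j)).
have aE i : mu (C i) = (a i)%:E by rewrite fineK// fin_num_measure.
have bE i : nu (C i) = (b i)%:E by rewrite fineK// fin_num_measure.
(* A null cell forces its row or column of [la] to vanish, so the quotients by zero in the weights
   lose no mass. *)
have la_a i j : a i = 0 -> la i j = 0.
  rewrite /a -laa => /eqP; rewrite psumr_eq0// => /allP/(_ j).
  by rewrite mem_index_enum => /(_ isT)/eqP.
have la_b i j : b j = 0 -> la i j = 0.
  rewrite /b -lab => /eqP; rewrite psumr_eq0// => /allP/(_ i).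
  by rewrite mem_index_enum => /(_ isT)/eqP.
have w0 (p : 'I_n * 'I_n) : 0 <= la p.1 p.2 / (a p.1 * b p.2).
  by rewrite divr_ge0// mulr_ge0// fine_ge0.
have mCC (p : 'I_n * 'I_n) : measurable (C p.1 `*` C p.2) by exact: measurableX.
pose N := #|{: 'I_n * 'I_n}|.
pose m (k : nat) : measure (T * T)%type R :=
  if insub k is Some k' then
    mscale (NngNum (w0 (enum_val (k' : 'I_N)))) (mrestr P (mCC (enum_val k')))
  else mzero.
pose gam : measure (T * T)%type R := msum m N.
have gamE E : gam E = (\sum_i \sum_j (la i j / (a i * b j))%:E * P (E `&` (C i `*` C j)))%E.
  rewrite /gam /= /msum pair_bigA /= (reindex (fun k : 'I_N => enum_val k)) /=; last first.
    by exists enum_rank => k _; [exact: enum_valK|exact: enum_rankK].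
  by apply: eq_bigr => k _; rewrite /m valK.
have PX A B : measurable A -> measurable B -> P (A `*` B) = (mu A * nu B)%E.
  by move=> mA mB; exact: product_measure1E.
have gamX A B : measurable A -> measurable B -> gam (A `*` B) =
  (\sum_i \sum_j (la i j / (a i * b j))%:E * (mu (A `&` C i) * nu (B `&` C j)))%E.
  move=> mA mB; rewrite gamE; apply: eq_bigr => i _; apply: eq_bigr => j _.
  by rewrite -setXI PX//; exact: measurableI.
have gam1 A : measurable A -> gam (A `*` setT) = mu A.
  move=> mA; rewrite gamX// (measure_cells _ _ _ _ mC tC muC mA); apply: eq_bigr => i _.
  have -> : mu (A `&` C i) = (fine (mu (A `&` C i)))%:E
    by rewrite fineK// fin_num_measure//; exact: measurableI.
  under eq_bigr do rewrite setTI bE -!EFinM.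
  rewrite sumEFin; congr EFin.
  have [ai0|ai0] := eqVneq (a i) 0.
    have -> : mu (A `&` C i) = 0%E.
      apply: (@subset_measure0 _ _ _ mu _ (C i)) => //; first exact: measurableI.
      by rewrite -[LHS]/(mu (C i)) aE ai0.
    by rewrite big1// => j _; rewrite !mul0r mulr0.
  (* Inserting [a i / a i], with the numerator written as the row sum of [la], makes both sides
     agree term by term. *)
  rewrite -[RHS]mul1r -(mulfV ai0) [X in _ = X / _ * _](_ : _ = \sum_j la i j)// !mulr_suml.
  apply: eq_bigr => j _.
  have [bj0|bj0] := eqVneq (b j) 0; first by rewrite la_b// !mul0r.
  by field; rewrite ?ai0 ?bj0.
have gam2 A : measurable A -> gam (setT `*` A) = nu A.
  move=> mA; rewrite gamX// (measure_cells _ _ _ _ mC tC nuC mA) exchange_big.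
  apply: eq_bigr => j _ /=.
  have -> : nu (A `&` C j) = (fine (nu (A `&` C j)))%:E
    by rewrite fineK// fin_num_measure//; exact: measurableI.
  under eq_bigr do rewrite setTI aE -!EFinM.
  rewrite sumEFin; congr EFin.
  have [bj0|bj0] := eqVneq (b j) 0.
    have -> : nu (A `&` C j) = 0%E.
      apply: (@subset_measure0 _ _ _ nu _ (C j)) => //; first exact: measurableI.
      by rewrite -[LHS]/(nu (C j)) bE bj0.
    by rewrite big1// => i _; rewrite !mulr0.
  rewrite -[RHS]mul1r -(mulfV bj0) [X in _ = X / _ * _](_ : _ = \sum_i la i j)// !mulr_suml.
  apply: eq_bigr => i _.
  have [ai0|ai0] := eqVneq (a i) 0; first by rewrite la_a// !mul0r.
  by field; rewrite ?ai0 ?bj0.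
have gamT : gam setT = 1%E by rewrite -setXTT gam1// probability_setT.
have [gam' gam'E] := measure_probability gam gamT.
exists gam'; split=> [A mA|i j]; rewrite !gam'E; first by split; [exact: gam1|exact: gam2].
rewrite gamX//.
have CC k l : k != l -> C k `&` C l = set0.
  by move=> kl; move/trivIsetP : tC; exact.
rewrite (bigD1 i)//= (bigD1 j)//= !setIid [X in (_ + X + _)%E]big1 ?[X in (_ + X)%E]big1 ?adde0.
- rewrite aE bE -!EFinM; congr EFin.
  have [ai0|ai0] := eqVneq (a i) 0; first by rewrite ai0 la_a// !mul0r.
  have [bj0|bj0] := eqVneq (b j) 0; first by rewrite bj0 la_b// !mul0r.
  by field; rewrite ?ai0 ?bj0.
- move=> k ki; rewrite big1// => l _; rewrite CC 1?eq_sym// measure0 mul0e mule0//.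
- by move=> l lj; rewrite [C j `&` _]CC 1?eq_sym// measure0 !mule0.
Qed.
End Glue.

(** * Supports and cells in R^d *)

Section BorelRd.
Context {R : realType} {d : nat}.
Implicit Types (Om U : set 'rV[R]_d) (mu : probability (Rd R d) R).

Lemma open_measurable_Rd U : open U -> measurable (U : set (Rd R d)).
Proof. by move=> oU; exact: sub_sigma_algebra. Qed.

Lemma within_continuous_measurable_Rd Om (f : 'rV[R]_d -> R) :
  open Om -> {within Om, continuous f} -> measurable_fun (Om : set (Rd R d)) f.
Proof.
move=> oOm; rewrite continuous_open_subspace// => /(continuous_inP _ oOm) cf.
apply: (measurability _ (RGenOpens.measurableE R)).
move=> _ [_ [a [b ->] <-]]; apply: open_measurable_Rd.
by apply: cf; exact: interval_open.
Qed.

Lemma continuous_measurable_Rd (f : 'rV[R]_d -> R) :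
  continuous f -> measurable_fun (setT : set (Rd R d)) f.
Proof.
move=> cf; apply: within_continuous_measurable_Rd; first exact: openT.
exact: continuous_subspaceT.
Qed.

(** The product sigma-algebra is generated by rectangles rather than by the open sets of the
    product, so measurability is built up from the coordinates. *)
Lemma measurable_eucl_sub : measurable_fun (setT : set (Rd R d * Rd R d))
  (fun p => eucl ((p.1 : 'rV[R]_d) - (p.2 : 'rV[R]_d))).
Proof.
pose g := fun p : Rd R d * Rd R d => \sum_(i < d) ((p.1 : 'rV[R]_d) - (p.2 : 'rV[R]_d)) ord0 i ^+ 2.
rewrite [X in measurable_fun _ X](_ : _ = @Num.sqrt R \o g)//.
apply: measurableT_comp.
  by apply: continuous_measurable_fun; exact: sqrt_continuous.
rewrite /g; apply: (@measurable_sum _ _ _ _ _ (index_enum 'I_d)) => i.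
apply: measurable_funX.
have -> : (fun p : Rd R d * Rd R d => ((p.1 : 'rV[R]_d) - (p.2 : 'rV[R]_d)) ord0 i) =
          (fun p => (p.1 : 'rV[R]_d) ord0 i - (p.2 : 'rV[R]_d) ord0 i).
  by apply/funext => p; rewrite !mxE.
have mi : measurable_fun (setT : set (Rd R d)) (fun x : 'rV[R]_d => x ord0 i).
  by apply: continuous_measurable_Rd; exact: coord_continuous.
by apply: measurable_funB; apply: (measurableT_comp mi).
Qed.

(** The union of all null open sets may be uncountable, but it is open; this form makes the support
    Borel. *)
Lemma suppE Om mu : supp Om mu =
  Om `&` ~` \bigcup_(U in [set U : set 'rV[R]_d | open U /\ mu (U : set (Rd R d)) = 0%E]) U.
Proof.
apply/seteqP; split=> x [Ox Hx]; split=> //.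
- by move=> [U [oU U0] Ux]; have := Hx _ oU Ux; rewrite U0 ltxx.
- move=> U oU Ux; rewrite lt0e measure_ge0 andbT; apply/eqP => U0.
  by apply: Hx; exists U.
Qed.

Lemma measurable_supp Om mu : open Om -> measurable (supp Om mu : set (Rd R d)).
Proof.
move=> oOm; rewrite suppE; apply: measurableI; first exact: open_measurable_Rd.
apply: measurableC; apply: open_measurable_Rd.
by apply: bigcup_open => U [].
Qed.

(** [Z] is the union of the null balls of a finite net of radius [e]. A net ball containing [x] lies
    in the ball of radius 2e about [x], so it is null whenever the larger one is. *)
Lemma null_balls Om mu (M e : R) : (forall x, Om x -> eucl x <= M) -> 0 < e ->
  exists Z : set 'rV[R]_d, mu.-negligible (Z : set (Rd R d)) /\
    forall x, Om x -> mu ([set y | eucl (y - x) < e + e] : set (Rd R d)) = 0%E -> Z x.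
Proof.
move=> OmM e0; have [n [c cP]] := finite_net _ _ _ OmM e0.
pose B i : set (Rd R d) := [set y | eucl (y - c i) < e].
have mB i : measurable (B i) by apply: open_measurable_Rd; exact: open_eucl_ball.
exists (\big[setU/set0]_(i < n | mu (B i) == 0%E) B i); split.
  apply: (big_ind (fun Z : set (Rd R d) => mu.-negligible Z)).
  - exact: negligible_set0.
  - by move=> ? ?; exact: negligibleU.
  - by move=> i /eqP Bi0; exists (B i); split.
move=> x Ox x0; have [i xi] := cP _ Ox.
have Bi0 : mu (B i) = 0%E.
  apply: (@subset_measure0 _ _ _ mu _ ([set y | eucl (y - x) < e + e] : set (Rd R d))) => //.
  - by apply: open_measurable_Rd; exact: open_eucl_ball.
  - move=> y /= yi; apply: (le_lt_trans (eucl_dist_triangle y (c i) x)).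
    by rewrite ltrD// eucl_sym.
by rewrite (bigD1 i) ?Bi0//=; left.
Qed.

(** A point of [Om] off the support has a null ball about it, hence one of radius 2/(k+1) for some
    k, and falls into the k-th null set given by [null_balls]. The nets thus replace an uncountable
    union of null sets by a countable one. *)
Lemma supp_full Om mu : bounded_domain Om -> prob_on Om mu ->
  mu (~` supp Om mu : set (Rd R d)) = 0%E.
Proof.
move=> [_ [oOm [_ [M OmM]]]] muOm.
apply/negligibleP; first by apply: measurableC; exact: measurable_supp.
have /choice[Z ZP] : forall k : nat, exists Z : set 'rV[R]_d,
    mu.-negligible (Z : set (Rd R d)) /\ forall x, Om x ->
      mu ([set y | eucl (y - x) < k.+1%:R^-1 + k.+1%:R^-1] : set (Rd R d)) = 0%E -> Z x.
  by move=> k; apply: null_balls OmM _; rewrite invr_gt0.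
apply: (@negligibleS _ _ _ mu ((~` Om : set (Rd R d)) `|` \bigcup_k (Z k : set (Rd R d)))).
  rewrite suppE setCI setCK => x [nOx|[U [oU U0] Ux]]; first by left.
  have [Ox|nOx] := pselect (Om x); last by left.
  right; have [e e0 eU] := eucl_ball_subset _ _ oU Ux.
  have [k _ ke] : exists2 k : nat, True & k.+1%:R^-1 < e / 2.
    have /archimedean.Num.Theory.archi_boundP := ltW (divr_gt0 (ltr0Sn R 1) e0).
    set k := archimedean.Num.bound _ => ke; exists k => //.
    rewrite invf_plt ?posrE ?divr_gt0// invf_div; apply: (lt_trans ke).
    by rewrite ltr_nat.
  exists k => //; apply: (ZP k).2 => //.
  apply: (@subset_measure0 _ _ _ mu _ (U : set (Rd R d))) => //.
  - by apply: open_measurable_Rd; exact: open_eucl_ball.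
  - exact: open_measurable_Rd.
  - by move=> y /= yx; apply: eU => /=; apply: (lt_trans yx); rewrite (splitr e) ltrD.
apply: negligibleU; last by apply: negligible_bigcup => k; exact: (ZP k).1.
by apply/negligibleP => //; apply: measurableC; exact: open_measurable_Rd.
Qed.

Lemma partition_cells Om (M e : R) : open Om -> (forall x, Om x -> eucl x <= M) -> 0 < e ->
  exists (n : nat) (c : 'I_n -> 'rV[R]_d) (C : 'I_n -> set (Rd R d)),
    [/\ forall i, measurable (C i), trivIset setT C,
        \big[setU/set0]_i C i = Om &
        forall i x, C i x -> eucl ((x : 'rV[R]_d) - c i) < e].
Proof.
move=> oOm OmM e0; have [n [c cP]] := finite_net _ _ _ OmM e0.
pose B i : set (Rd R d) := [set y | eucl (y - c i) < e].
have mB i : measurable (B i) by apply: open_measurable_Rd; exact: open_eucl_ball.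
(* Removing the earlier balls makes the cells disjoint; a point of [Om] lies in the cell of the
   least index whose ball contains it. *)
pose C (i : 'I_n) : set (Rd R d) :=
  ((Om : set (Rd R d)) `&` B i) `&` ~` \big[setU/set0]_(j < n | (j < i)%N) B j.
have CP i x : C i x -> [/\ Om x, B i x & forall j : 'I_n, (j < i)%N -> ~ B j x].
  move=> [[Ox Bx] nB]; split=> // j ji Bj; apply: nB.
  by rewrite (bigD1 j)//=; left.
exists n, c, C; split.
- move=> i; apply: measurableI; first apply: measurableI => //.
    exact: open_measurable_Rd.
  by apply: measurableC; apply: bigsetU_measurable => j _.
- move=> i j _ _ [x [/CP[_ Bi nBi] /CP[_ Bj nBj]]]; apply/val_inj/eqP.
  rewrite eqn_leq; apply/andP; split; rewrite leqNgt; apply/negP.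
    by move=> /nBi; apply.
  by move=> /nBj; apply.
- apply/seteqP; split=> x.
    apply: (big_ind (fun Z : set (Rd R d) => Z x -> Om x)) => //.
      by move=> U V UO VO [/UO|/VO].
    by move=> i _ /CP[].
  move=> Ox; have [i0 xi0] := cP _ Ox.
  have [i /asboolP Bi imin] := arg_minnP (P := fun i => `[<B i x>])
    (fun i : 'I_n => i : nat) (asboolT xi0).
  rewrite (bigD1 i)//=; left; split=> //.
  apply: (big_ind (fun Z : set (Rd R d) => ~ Z x)) => //.
    by move=> U V UO VO [/UO|/VO].
  move=> j ji Bj; have := imin j (asboolT Bj); by rewrite leqNgt ji.
- by move=> i x /CP[].
Qed.

End BorelRd.

(** * Integrals over cells and couplings *)

Lemma bounded_integrable {dd : measure_display} {T : measurableType dd} {R : realType}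
    (mu : probability T R) (D : set T) (f : T -> R) (K : R) :
  measurable D -> measurable_fun D f -> (forall x, D x -> `|f x| <= K) ->
  mu.-integrable D (EFin \o f).
Proof.
move=> mD mf fK; apply: measurable_bounded_integrable => //.
  by rewrite ltey_eq fin_num_measure.
exists K; split; first exact: num_real.
by move=> N KN x /= Dx; exact: le_trans (fK _ Dx) (ltW KN).
Qed.

Section Integrals.
Context {dd : measure_display} {T : measurableType dd} {R : realType}.

(** Over [C i] the error is at most [e * mu (C i)], and the masses of the cells sum to 1. *)
Lemma integral_cells (mu : probability T R) (n : nat) (C : 'I_n -> set T) (f : T -> R)
    (v : 'I_n -> R) (e : R) :
  (forall i, measurable (C i)) -> trivIset setT C ->
  mu (~` (\big[setU/set0]_i C i)) = 0%E ->
  measurable_fun (\big[setU/set0]_i C i) f ->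
  (forall i x, C i x -> `|f x - v i| <= e) ->
  exists2 r : R, (\int[mu]_(x in \big[setU/set0]_i C i) (f x)%:E)%E = r%:E &
    `|r - \sum_i v i * fine (mu (C i))| <= e.
Proof.
move=> mC tC muC mf fv.
have mfC i : measurable_fun (C i) f.
  apply: measurable_funS mf => //; first exact: bigsetU_measurable.
  by rewrite (bigD1 i)//=; exact: subsetUl.
have iC i : mu.-integrable (C i) (EFin \o f).
  apply: (bounded_integrable mu (C i) f (e + `|v i|)) => // x Cx.
  by rewrite -[f x](subrK (v i)); apply: (le_trans (ler_normD _ _)); rewrite lerD2r fv.
have icst i k : mu.-integrable (C i) (cst k%:E).
  by apply: (bounded_integrable mu (C i) (cst k) `|k|).
have muE i : mu (C i) = (fine (mu (C i)))%:E by rewrite fineK// fin_num_measure.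
have Cr i : exists r : R, (\int[mu]_(x in C i) (f x)%:E)%E = r%:E /\
    `|r - v i * fine (mu (C i))| <= e * fine (mu (C i)).
  exists (fine (\int[mu]_(x in C i) (f x)%:E)); split.
    by rewrite fineK//; exact: integrable_fin_num.
  rewrite ler_distl -mulrBl -mulrDl -!lee_fin fineK; last exact: integrable_fin_num.
  rewrite !EFinM -muE -!(integral_cst mu) //; apply/andP; split.
    apply: le_integral => // x; rewrite inE => Cx.
    by rewrite lee_fin lerBlDr -lerBlDl (le_trans _ (fv i x Cx))// distrC ler_norm.
  apply: le_integral => // x; rewrite inE => Cx.
  by rewrite lee_fin -lerBlDl (le_trans _ (fv i x Cx))// ler_norm.
have /choice[r rP] := Cr.
exists (\sum_i r i).
  rewrite integral_bigsetU_EFin//.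
  - by rewrite -sumEFin; apply: eq_bigr => i _; exact: (rP i).1.
  - exact: index_enum_uniq.
  - by apply: sub_trivIset tC.
  - exact/measurable_EFinP.
rewrite -sumrB; apply: (le_trans (ler_norm_sum _ _ _)).
apply: (le_trans (ler_sum _ (fun i _ => (rP i).2))).
by rewrite -mulr_sumr (sum_measure_cells mu)// mulr1.
Qed.

Lemma integral_le_cells (gam : probability (T * T)%type R) (n : nat) (C : 'I_n -> set T)
    (U : set T) (c : T * T -> R) (k : 'I_n -> 'I_n -> R) :
  (forall i, measurable (C i)) -> trivIset setT C -> \big[setU/set0]_i C i = U ->
  measurable_fun setT c -> (forall p, 0 <= c p) ->
  (forall i j x y, C i x -> C j y -> c (x, y) <= k i j) ->
  (\int[gam]_(p in U `*` U) (c p)%:E <= \sum_i \sum_j (k i j)%:E * gam (C i `*` C j))%E.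
Proof.
move=> mC tC UE mc c0 ck.
pose CC (p : 'I_n * 'I_n) := C p.1 `*` C p.2.
have -> : U `*` U = \big[setU/set0]_(p <- index_enum ('I_n * 'I_n)%type) CC p.
  rewrite -bigcup_seq -UE; apply/seteqP; split => [[x y]|[x y]] /=.
    rewrite -!bigcup_seq => -[[i _ Cx] [j _ Cy]].
    by exists (i, j) => //=; rewrite mem_index_enum.
  move=> [[i j] _ [/= Cx Cy]]; rewrite -!bigcup_seq.
  by split; [exists i|exists j] => //=; rewrite mem_index_enum.
have mCC p : measurable (CC p) by exact: measurableX.
rewrite ge0_integral_bigsetU//=; last 4 first.
- exact: index_enum_uniq.
- move=> [i j] [i' j'] _ _ [[x y] [[/= Cx Cy] [/= Cx' Cy']]].
  by congr pair; apply: tC => //; [exists x|exists y].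
- by apply/measurable_EFinP; exact: measurable_funTS.
- by move=> x _; rewrite lee_fin.
rewrite pair_bigA /=; apply: lee_sum => -[i j] _ /=.
rewrite -(integral_cst gam (mCC (i, j))); apply: ge0_le_integral => //.
- by move=> x _; rewrite lee_fin.
- by apply/measurable_EFinP; exact: measurable_funTS.
- by move=> [x y] [/= Cx Cy]; rewrite lee_fin ck.
Qed.

Lemma integral_marginal (mu : probability T R) (gam : probability (T * T)%type R)
    (pr : T * T -> T) (f : T -> R) (K : R) :
  measurable_fun setT pr -> (forall A, measurable A -> gam (pr @^-1` A) = mu A) ->
  measurable_fun setT f -> (forall x, `|f x| <= K) ->
  (\int[mu]_x (f x)%:E = \int[gam]_p (f (pr p))%:E)%E.
Proof.
move=> mpr prE mf fK.
transitivity (\int[pushforward gam pr]_x (EFin \o f) x)%E.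
  by apply: eq_measure_integral => A mA _; exact: (esym (prE A mA)).
rewrite integral_pushforward//; first exact/measurable_EFinP.
by apply: (bounded_integrable gam setT (f \o pr) K) => [//||p _];
    [exact: measurableT_comp|exact: fK].
Qed.

(** [f] and [g] are kept apart because one potential will be cut off outside two different supports,
    with [D] their product. *)
Lemma weak_duality (mu nu : probability T R) (gam : probability (T * T)%type R)
    (D : set (T * T)) (f g : T -> R) (c : T * T -> R) (K : R) :
  (forall A, measurable A -> gam (A `*` setT) = mu A /\ gam (setT `*` A) = nu A) ->
  measurable D -> gam (~` D) = 0%E ->
  measurable_fun setT f -> measurable_fun setT g -> measurable_fun setT c ->
  (forall x, `|f x| <= K) -> (forall x, `|g x| <= K) -> (forall p, D p -> `|c p| <= K) ->
  (forall p, D p -> f p.1 - g p.2 <= c p) ->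
  (\int[mu]_x (f x)%:E - \int[nu]_x (g x)%:E <= \int[gam]_(p in D) (c p)%:E)%E.
Proof.
move=> gamE mD gamD mf mg mc fK gK cK fgc.
have mf1 : measurable_fun setT (f \o fst : T * T -> R) by exact: measurableT_comp.
have mg2 : measurable_fun setT (g \o snd : T * T -> R) by exact: measurableT_comp.
rewrite (integral_marginal mu gam fst f K)//; last first.
  by move=> A mA; rewrite -(gamE A mA).1; congr (gam _); apply/seteqP; split=> [] [x y] //= [].
rewrite (integral_marginal nu gam snd g K)//; last first.
  by move=> A mA; rewrite -(gamE A mA).2; congr (gam _); apply/seteqP; split=> [] [x y] //= [].
have intD (h : T * T -> R) : measurable_fun setT h -> (forall p, `|h p| <= K) ->
    (\int[gam]_p (h p)%:E = \int[gam]_(p in D) (h p)%:E)%E.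
  move=> mh hK; rewrite (@negligible_integral _ _ _ gam setT (~` D))//.
  - by rewrite setTD setCK.
  - exact: measurableC.
  - exact: (bounded_integrable gam setT h K).
rewrite (intD (fun p => f p.1))// (intD (fun p => g p.2))// -integralB_EFin//; last 2 first.
- by apply: (bounded_integrable gam D (f \o fst) K) => [//||p _];
    [exact: measurable_funTS|exact: fK].
- by apply: (bounded_integrable gam D (g \o snd) K) => [//||p _];
    [exact: measurable_funTS|exact: gK].
apply: le_integral => //.
- apply: (bounded_integrable gam D (fun p => f p.1 - g p.2) (K + K)) => //.
    by apply: measurable_funTS; exact: measurable_funB.
  by move=> p _; apply: (le_trans (ler_normB _ _)); rewrite lerD.
- by apply: (bounded_integrable gam D c K) => //; exact: measurable_funTS.
- by move=> p; rewrite inE => Dp; rewrite -EFinB lee_fin fgc.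
Qed.
End Integrals.

(** * Kantorovich duality *)

Section Potential.
Context {R : realType} {d : nat}.

Lemma lipschitz_norm (f : 'rV[R]_d -> R) :
  (forall x y, f x - f y <= eucl (x - y)) -> forall x y, `|f x - f y| <= eucl (x - y).
Proof.
by move=> fL x y; rewrite ler_norml fL andbT lerNl opprB eucl_sym fL.
Qed.

Lemma lipschitz_continuous (f : 'rV[R]_d -> R) :
  (forall x y, f x - f y <= eucl (x - y)) -> continuous f.
Proof.
move=> fL x; apply/(@cvgrPdist_lt _ R^o _ (nbhs x) (nbhs_filter x)) => e e0.
near=> y; rewrite distrC; apply: (le_lt_trans (lipschitz_norm _ fL _ _)).
near: y; apply: (open_nbhs_nbhs (A := [set y | eucl (y - x) < e])).
by split; [exact: open_eucl_ball|rewrite /= subrr eucl0].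
Unshelve. all: by end_near.
Qed.

Lemma lipschitz_Cb (Om : set 'rV[R]_d) (M : R) (f : 'rV[R]_d -> R) :
  (forall x, Om x -> eucl x <= M) ->
  (forall x y, f x - f y <= eucl (x - y)) -> Cb Om f.
Proof.
move=> OmM fL; split; first by apply: continuous_subspaceT; exact: lipschitz_continuous.
exists (M + `|f 0|) => x Ox; rewrite -[f x](subrK (f 0)).
apply: (le_trans (ler_normD _ _)); rewrite lerD2r.
by apply: (le_trans (lipschitz_norm _ fL _ _)); rewrite subr0 OmM.
Qed.

(* Besides initialising the minimum, K truncates it: harmless once K >= phi_i for all i. *)
Definition potential {n : nat} (K : R) (c : 'I_n -> 'rV[R]_d) (psi : 'I_n -> R)
    (x : 'rV[R]_d) : R :=
  \big[Num.min/K]_(j < n) (eucl (x - c j) + psi j).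

(** The constant [K] and each term of the minimum are 1-Lipschitz, the latter by the triangle
    inequality, and minima preserve this. *)
Lemma potential_lipschitz n K (c : 'I_n -> 'rV[R]_d) psi x y :
  potential K c psi x - potential K c psi y <= eucl (x - y).
Proof.
rewrite lerBlDr -lerBlDl; apply: le_bigmin => [|j _].
  rewrite lerBlDl (le_trans (bigmin_le_id _ _ _ _))// lerDr.
  exact: eucl_ge0.
rewrite lerBlDl; apply: (@bigmin_inf _ _ _ _ j) => //.
by rewrite addrA lerD2r; exact: eucl_dist_triangle.
Qed.
End Potential.

Section Duality.
Context {R : realType} {d : nat} (Om : set 'rV[R]_d) (mu nu : probability (Rd R d) R).
Hypotheses (dOm : bounded_domain Om) (muOm : prob_on Om mu) (nuOm : prob_on Om nu).

(** A potential in [Cb] is controlled only on [Om]; extending it by zero off the support, a set of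
    full measure, gives a bounded measurable function on the whole space. *)
Lemma integral_supp (m : probability (Rd R d) R) (phi : 'rV[R]_d -> R) :
  prob_on Om m -> Cb Om phi ->
  (\int[m]_(x in (Om : set (Rd R d))) (phi x)%:E =
   \int[m]_x ((phi : Rd R d -> R) \_ (supp Om m : set (Rd R d)) x)%:E)%E.
Proof.
move=> mOm [cphi [K phiK]]; have [_ [oOm _]] := dOm.
have mO : measurable (Om : set (Rd R d)) by exact: open_measurable_Rd.
rewrite (@negligible_integral _ _ _ m (Om : set (Rd R d)) (~` (supp Om m : set (Rd R d))))//.
- rewrite setDE setCK setIidr; last by move=> x [].
  rewrite integral_mkcond; apply: eq_integral => x _.
  by rewrite !patchE; case: ifP.
- by apply: measurableC; exact: measurable_supp.
- apply: (bounded_integrable m _ phi K) => //.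
  exact: within_continuous_measurable_Rd.
- exact: supp_full.
Qed.

Lemma le_cost (gam : probability (Rd R d * Rd R d)%type R) (phi : 'rV[R]_d -> R) :
  coupling mu nu gam -> Cb Om phi -> admissible Om mu nu phi ->
  (\int[mu]_(x in (Om : set (Rd R d))) (phi x)%:E
   - \int[nu]_(x in (Om : set (Rd R d))) (phi x)%:E <=
   \int[gam]_(p in (Om `*` Om : set (Rd R d * Rd R d)))
           (eucl ((p.1 : 'rV[R]_d) - (p.2 : 'rV[R]_d)))%:E)%E.
Proof.
move=> gamE cphi adm; rewrite !integral_supp//.
have [_ [oOm [_ [M OmM]]]] := dOm; have [ct [K phiK]] := cphi.
have mO : measurable (Om : set (Rd R d)) by exact: open_measurable_Rd.
pose A : set (Rd R d) := supp Om mu; pose B : set (Rd R d) := supp Om nu.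
have mA : measurable A by exact: measurable_supp.
have mB : measurable B by exact: measurable_supp.
have AOm x : A x -> Om x by case.
have BOm x : B x -> Om x by case.
have mphi : measurable_fun (Om : set (Rd R d)) phi by exact: within_continuous_measurable_Rd.
have K0 : 0 <= K by have [[x Ox] _] := dOm; exact: le_trans (phiK _ Ox).
have M0 : 0 <= M by have [[x Ox] _] := dOm; exact: le_trans (eucl_ge0 _) (OmM _ Ox).
have restr (C : set (Rd R d)) : measurable C -> (forall x, C x -> Om x) ->
    measurable_fun setT ((phi : Rd R d -> R) \_ C) /\
    forall x, `|((phi : Rd R d -> R) \_ C) x| <= K + (M + M).
  move=> mC COm; split.
    apply/(measurable_restrictT _ mC); exact: (measurable_funS mO COm mphi).
  move=> x; rewrite patchE; case: ifPn => [|_]; last by rewrite normr0 !addr_ge0.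
  by rewrite inE => /COm/phiK phix; apply: (le_trans phix); rewrite lerDl addr_ge0.
(* The integral is first bounded over the product of supports, where admissibility applies, and then
   enlarged since the cost is nonnegative. [K] bounds the potential and [M + M] the distances within
   [Om]. *)
apply: (@le_trans _ _ (\int[gam]_(p in A `*` B) (eucl ((p.1 : 'rV[R]_d) - (p.2 : 'rV[R]_d)))%:E)%E).
  apply: (weak_duality mu nu gam (A `*` B) _ _
    (fun p => eucl ((p.1 : 'rV[R]_d) - (p.2 : 'rV[R]_d))) (K + (M + M))) => //.
  - exact: measurableX.
  (* Two strips cover the complement of [A x B]; by the marginal conditions both are null. *)
  - have gA : gam (~` A `*` setT) = 0%E.
      by rewrite (gamE _ (measurableC mA)).1; exact: supp_full.
    have gB : gam (setT `*` ~` B) = 0%E.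
      by rewrite (gamE _ (measurableC mB)).2; exact: supp_full.
    apply/negligibleP; first by apply: measurableC; exact: measurableX.
    apply: (@negligibleS _ _ _ gam ((~` A `*` setT) `|` (setT `*` ~` B))).
      move=> [x y] /= AB; have [Ax|nAx] := pselect (A x); last by left.
      by right; split=> // By; apply: AB.
    by apply: negligibleU; apply/negligibleP => //; apply: measurableX => //; exact: measurableC.
  - exact: (restr A mA AOm).1.
  - exact: (restr B mB BOm).1.
  - exact: measurable_eucl_sub.
  - exact: (restr A mA AOm).2.
  - exact: (restr B mB BOm).2.
  - move=> [x y] [/= /AOm/OmM Ax /BOm/OmM By]; rewrite ger0_norm ?eucl_ge0//.
    apply: (le_trans (eucl_dist_triangle x 0 y)); rewrite subr0 eucl_sym subr0.
    by rewrite -[leLHS]add0r lerD// lerD.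
  - by move=> [x y] [/= Ax By]; rewrite !patchE !mem_set//; exact: adm.
apply: ge0_subset_integral => //.
- exact: measurableX.
- exact: measurableX.
- by apply/measurable_EFinP; apply: measurable_funTS; exact: measurable_eucl_sub.
- by move=> p _; rewrite lee_fin eucl_ge0.
- by move=> [x y] [/= /AOm Ax /BOm By].
Qed.

(** Of the four errors [e], two come from replacing a potential by its values at the centres in the
    integrals against [mu] and [nu], and two from moving both endpoints of a transport to
    centres. *)
Lemma near_optimal_coupling (s e : R) :
  0 < e ->
  (forall phi, (forall x y, phi x - phi y <= eucl (x - y)) ->
    (\int[mu]_(x in (Om : set (Rd R d))) (phi x)%:E
         - \int[nu]_(x in (Om : set (Rd R d))) (phi x)%:E <= s%:E)%E) ->
  exists2 gam : probability (Rd R d * Rd R d)%type R, coupling mu nu gam &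
    (\int[gam]_(p in (Om `*` Om : set (Rd R d * Rd R d)))
           (eucl ((p.1 : 'rV[R]_d) - (p.2 : 'rV[R]_d)))%:E <= (s + (e + e) + (e + e))%:E)%E.
Proof.
move=> e0 Hs; have [_ [oOm [_ [M OmM]]]] := dOm.
have [n [c [C [mC tC CE Ce]]]] := partition_cells _ _ _ oOm OmM e0.
have muC : mu (~` (\big[setU/set0]_i C i)) = 0%E by rewrite CE.
have nuC : nu (~` (\big[setU/set0]_i C i)) = 0%E by rewrite CE.
pose a i := fine (mu (C i)); pose b i := fine (nu (C i)).
have a0 i : 0 <= a i by rewrite fine_ge0.
have b0 i : 0 <= b i by rewrite fine_ge0.
have a1 : \sum_i a i = 1 by exact: sum_measure_cells.
have b1 : \sum_i b i = 1 by exact: sum_measure_cells.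
have [phi psi pp|la [la0 laa lab lav]] := finite_duality R n
    (fun i j => eucl (c i - c j)) a b (s + (e + e)) a0 b0 a1 b1.
  (* Since [phi i <= f (c i)] and [f (c j) <= psi j], the discrete dual value of a feasible pair is
     at most that of [f]. This [K] lies above every [phi i]. *)
  pose K := \sum_i `|phi i|.
  pose f := potential K c psi.
  have fL : forall x y, f x - f y <= eucl (x - y) by exact: potential_lipschitz.
  have phif i : phi i <= f (c i).
    apply: le_bigmin => [|j _]; last by rewrite -lerBlDr pp.
    rewrite /K (bigD1 i)//= (le_trans (ler_norm _))// lerDl; exact: sumr_ge0.
  have psif j : f (c j) <= psi j.
    by apply: (@bigmin_inf _ _ _ _ j) => //; rewrite subrr eucl0 add0r.
  have mf : measurable_fun (Om : set (Rd R d)) f.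
    apply: within_continuous_measurable_Rd => //.
    by apply: continuous_subspaceT; exact: lipschitz_continuous.
  have fC i x : C i x -> `|f x - f (c i)| <= e.
    by move=> Cx; apply: (le_trans (lipschitz_norm _ fL _ _)); exact/ltW/Ce.
  rewrite -CE in mf.
  have [r rE rP] := integral_cells mu n C f (fun i => f (c i)) e mC tC muC mf fC.
  have [q qE qP] := integral_cells nu n C f (fun i => f (c i)) e mC tC nuC mf fC.
  have := Hs f fL; rewrite -CE rE qE -EFinB lee_fin.
  have : \sum_i phi i * a i <= \sum_i f (c i) * a i.
    by apply: ler_sum => i _; exact: ler_wpM2r.
  have : \sum_i f (c i) * b i <= \sum_i psi i * b i.
    by apply: ler_sum => i _; exact: ler_wpM2r.
  move: rP qP; rewrite !ler_norml => /andP[r1 r2] /andP[q1 q2].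
  rewrite -/a -/b in r1 r2 q1 q2 *; lra.
have [gam [gamE gamC]] := exists_coupling_on_cells mu nu n C la mC tC muC nuC la0 laa lab.
exists gam; first exact: gamE.
apply: (@le_trans _ _ (\sum_i \sum_j (eucl (c i - c j) + (e + e))%:E * gam (C i `*` C j))%E).
  apply: (integral_le_cells gam n C Om
    (fun p => eucl ((p.1 : 'rV[R]_d) - (p.2 : 'rV[R]_d)))) => //.
  - exact: measurable_eucl_sub.
  - by move=> p; exact: eucl_ge0.
  - move=> i j x y /Ce xi /Ce yj /=.
    have := eucl_dist_triangle (x : 'rV[R]_d) (c i) y.
    have := eucl_dist_triangle (c i) (c j) (y : 'rV[R]_d).
    by rewrite [eucl (c j - _)]eucl_sym; lra.
under eq_bigr do under eq_bigr do rewrite gamC -EFinM.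
under eq_bigr do rewrite sumEFin.
rewrite sumEFin lee_fin.
(* The plan [la] has total mass 1, so the surcharge [e + e] is paid exactly once. *)
have -> : \sum_i \sum_j (eucl (c i - c j) + (e + e)) * la i j =
    \sum_i \sum_j la i j * eucl (c i - c j) + (e + e).
  under eq_bigr do under eq_bigr do rewrite mulrDl.
  under eq_bigr do rewrite big_split /= -mulr_sumr laa.
  rewrite big_split /= -mulr_sumr a1 mulr1; congr (_ + _).
  by apply: eq_bigr => i _; apply: eq_bigr => j _; rewrite mulrC.
by rewrite lerD2r.
Qed.
End Duality.

Theorem theorem1 (R : realType) (d : nat) (Om : set 'rV[R]_d)
  (mu nu : probability (Rd R d) R) :
  bounded_domain Om -> prob_on Om mu -> prob_on Om nu ->
  W1 Om mu nu =
  ereal_sup [set v | exists phi : 'rV[R]_d -> R,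
    Cb Om phi /\ admissible Om mu nu phi /\
    v = (\int[mu]_(x in (Om : set (Rd R d))) (phi x)%:E
         - \int[nu]_(x in (Om : set (Rd R d))) (phi x)%:E)%E].
Proof.
move=> dOm muOm nuOm; apply/le_anti/andP; split; last first.
  apply: ge_ereal_sup => _ [phi [cphi [adm ->]]].
  apply: le_ereal_inf_tmp => _ [gam [cgam ->]].
  exact: le_cost.
set S := ereal_sup _.
have [_ [_ [_ [M OmM]]]] := dOm.
have lipS phi : (forall x y, phi x - phi y <= eucl (x - y)) ->
    (\int[mu]_(x in (Om : set (Rd R d))) (phi x)%:E
         - \int[nu]_(x in (Om : set (Rd R d))) (phi x)%:E <= S)%E.
  move=> phiL; apply: ereal_sup_ubound; exists phi; split.
    exact: lipschitz_Cb OmM phiL.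
  by split=> // x y _ _; exact: phiL.
(* The zero potential rules out a supremum of -oo; at +oo there is nothing to prove. *)
have S0 : (0 <= S)%E.
  have := lipS (fun=> 0); rewrite !integral0 sube0; apply=> x y.
  by rewrite subr0 eucl_ge0.
move: lipS S0; case: S => [s|_ _|//]; last by rewrite leey.
move=> lipS _; apply/lee_addgt0Pr => e e0.
(* [near_optimal_coupling] loses four times its parameter. *)
have e40 : 0 < e / 4 by rewrite divr_gt0.
have [gam cgam gamS] := near_optimal_coupling Om mu nu dOm muOm nuOm s (e / 4) e40 lipS.
apply: (le_trans _ (le_trans gamS _)).
  by apply: ereal_inf_lbound; exists gam.
by rewrite -EFinD lee_fin; lra.
Qed.
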